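(* Let $J$ be a Jónsson algebra, let $\kappa=|J|$, and let $\theta$ be a congruence on $J$. (1) If $|J/\theta|=|J|$, then $J/\theta$ is also a Jónsson algebra. (2) If $|J/\theta|<\mathrm{cf}(|J|)$, then $J/\theta$ is cyclic (i.e., generated by a single element). (2$'$) If $\theta$ is a uniform congruence (all $\theta$-classes have the same cardinality) and $|J/\theta|<|J|$, then $J/\theta$ is a cyclic algebra that is generated by any one of its elements.
   Context: A Jónsson algebra is an infinite algebra $J$ in a countable algebraic language which has no proper subalgebra of the same cardinality as $J$. An algebra is cyclic if it is generated by one element. $\mathrm{cf}$ denotes cofinality. *)

(* Defs.v *)
From HB Require Import structures.
From mathcomp Require Import all_boot generic_quotient.
From mathcomp Require Import boolp classical_sets functions cardinality wochoice.

Set Implicit Arguments.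
Unset Strict Implicit.
Unset Printing Implicit Defensive.

Local Open Scope classical_set_scope.
Local Open Scope card_scope.
Local Open Scope quotient_scope.

Definition card_lt T U (A : set T) (B : set U) : Prop :=
  A #<= B /\ ~ (A #= B).

Notation "A '#<' B" := (card_lt A B) (at level 79) : card_scope.

Record language := Language {
  symbol :> Type;
  arity : symbol -> nat
}.

Record algebra (L : language) := Algebra {
  carrier :> choiceType;
  interp : forall f : L, ('I_(arity f) -> carrier) -> carrier
}.

Arguments interp {L a} f xs.

Section Algebras.
Context {L : language}.

Definition subalgebra (A : algebra L) (B : set A) : Prop :=
  forall (f : L) (xs : 'I_(arity f) -> A), (forall i, B (xs i)) -> B (interp f xs).

Definition jonsson (A : algebra L) : Prop :=
  [/\ countable [set: L],
      infinite_set [set: A] &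
      forall B : set A, subalgebra B -> B #= [set: A] -> B = [set: A]].

Definition generated_by (A : algebra L) (x : A) : Prop :=
  smallest (@subalgebra A) [set x] = [set: A].

Definition cyclic (A : algebra L) : Prop := exists x : A, generated_by x.

Record congruence (A : algebra L) := Congruence {
  congruence_equiv :> equiv_rel A;
  congruence_compat : forall (f : L) (xs ys : 'I_(arity f) -> A),
    (forall i, congruence_equiv (xs i) (ys i)) ->
    congruence_equiv (interp f xs) (interp f ys)
}.

Definition class_of (A : algebra L) (theta : congruence A) (x : A) : set A :=
  [set y | theta x y].

Definition uniform_congruence (A : algebra L) (theta : congruence A) : Prop :=
  forall x y : A, class_of theta x #= class_of theta y.

(* Operations are computed on chosen representatives; [interp_pi] shows that
   the choice is immaterial. *)
Definition quotient (A : algebra L) (theta : congruence A) : algebra L :=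
  {| carrier := {eq_quot theta};
     interp := fun (f : L) (xs : 'I_(arity f) -> {eq_quot theta}) =>
       \pi_{eq_quot theta} (interp f (fun i => repr (xs i))) |}.

Lemma interp_pi (A : algebra L) (theta : congruence A) (f : L)
    (xs : 'I_(arity f) -> A) :
  interp f (fun i => \pi_{eq_quot theta} (xs i) : quotient theta) =
  \pi_{eq_quot theta} (interp f xs).
Proof.
apply/eqmodP/congruence_compat => i.
by apply/eqmodP; rewrite reprK.
Qed.

End Algebras.

Section Cofinality.
Context {T : choiceType}.
Implicit Types (R : rel T) (C D : set T).

(* [R] is an initial ordinal: its order type is the cardinal of [T]. *)
Definition initial_well_order R : Prop :=
  well_order R /\ forall x, [set y | R y x && (y != x)] #< [set: T].

Definition cofinal R C : Prop := forall x, exists2 y, C y & R x y.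

Definition is_cofinality C : Prop :=
  exists2 R, initial_well_order R &
    cofinal R C /\ forall D, cofinal R D -> C #<= D.

End Cofinality.

(* A cardinal is represented by any set of that cardinality; the default value
   of [xget] is never used, by [cofinalityP]. *)
Definition cofinality (T : choiceType) : set T := xget set0 is_cofinality.
Arguments cofinality T : clear implicits.

Section CofinalityExists.
Context {T : choiceType}.

Lemma set_inj_card_le (A B : set T) (f : T -> T) :
  set_fun A B f -> set_inj A f -> A #<= B.
Proof.
move=> fAB fI; have [g] : $|{injfun A >-> B}| by apply/injfunPex; exists f.
exact: inj_card_le.
Qed.

Lemma ex_min_card (F : set (set T)) : F !=set0 ->
  exists2 C, F C & forall D, F D -> C #<= D.
Proof.
move=> [C0 FC0].
pose P : set (set (set T -> T)) := [set M |
  (forall g, M g -> forall D, F D -> D (g D)) /\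
  (forall g h, M g -> M h -> forall D, F D -> g D = h D -> g = h)].
have [|M [[Mch Minj] Mmax]] := @Zorn_bigcup _ P.
  move=> K KP Ktot; split.
    by move=> g [X KX Xg]; have [+ _] := KP _ KX; apply.
  move=> g h [X KX Xg] [Y KY Yh]; have [XY|YX] := Ktot _ _ KX KY.
    by have [_ +] := KP _ KY; apply => //; exact: XY.
  by have [_ +] := KP _ KX; apply => //; exact: YX.
have [[C FC CM]|noC] :=
    pselect (exists2 C, F C & forall x, C x -> exists2 g, M g & g C = x).
  exists C => // D FD.
  have /choice[G GP] : forall x, exists g, C x -> M g /\ g C = x.
    move=> x; have [Cx|nCx] := pselect (C x).
      by have [g Mg gx] := CM _ Cx; exists g.
    by exists (fun=> x).
  apply: (@set_inj_card_le _ _ (fun x => G x D)).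
    by move=> x /GP[MG _]; exact: (Mch _ MG).
  move=> x y /set_mem/GP[Mx Gx] /set_mem/GP[My Gy] e.
  by rewrite -Gx -Gy (Minj _ _ Mx My D FD e).
exfalso.
have /choice[g gP] : forall D, exists x, F D ->
    D x /\ forall h, M h -> h D <> x.
  move=> D; have [FD|nFD] := pselect (F D); last first.
    have [[x _]|T0] := pselect (exists x : T, True); first by exists x.
    exfalso; apply: noC; exists C0 => // x _.
    by exfalso; apply: T0; exists x.
  apply: contrapT => nx; apply: noC; exists D => // x Dx.
  apply: contrapT => nh; apply: nx; exists x => _; split => // h Mh hx.
  by apply: nh; exists h.
apply: (Mmax (M `|` [set g])).
  split=> [h Mh|MgM]; first by left.
  have Mg : M g by apply: MgM; right.
  by have [_ /(_ _ Mg)] := gP _ FC0.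
split=> [h [Mh|->] D FD|h k].
- exact: (Mch _ Mh).
- by have [] := gP _ FD.
move=> [Mh|->] [Mk|->] D FD e //.
- exact: Minj e.
- by have [_ /(_ _ Mh)] := gP _ FD.
- by have [_ /(_ _ Mk)] := gP _ FD; rewrite e.
Qed.

Lemma ex_initial_well_order : exists R : rel T, initial_well_order R.
Proof.
have [R Rwo] := well_ordering_principle T.
pose seg x := [set y | R y x && (y != x)].
have [small|] := pselect (forall x, seg x #< [set: T]); first by exists R.
have leT (A : set T) : A #<= [set: T] by exact: card_leT.
move/existsNP => [x0 /not_andP[/(_ (leT _))//|/contrapT x0T]].
have [|x [[/asboolP xT xmin] _]] := Rwo [pred x | `[< seg x #= [set: T] >]].
  by exists x0; apply/asboolP.
have anti : antisymmetric R.
  have Rch : wo_chain R predT by move=> A _; exact: Rwo.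
  by move=> a b; exact: (wo_chain_antisymmetric Rch).
have tr a b c : R a b -> R b c -> R a c.
  move=> ab bc; have [|z [[zin zmin] _]] := Rwo (pred3 a b c).
    by exists a; rewrite inE eqxx.
  have := zin; rewrite !inE => /or3P[] /eqP ez; subst z.
  - by apply: zmin; rewrite !inE eqxx !orbT.
  - have ba : R b a by apply: zmin; rewrite !inE eqxx.
    by rewrite (@anti a b) // ab.
  - have cb : R c b by apply: zmin; rewrite !inE eqxx !orbT.
    by rewrite (@anti c b) // ?cb // -(@anti c b) ?cb.
have lt_small y : R y x -> y != x -> seg y #< [set: T].
  move=> yx nyx; split => // yT; move/eqP: nyx; apply; apply: anti.
  by rewrite yx xmin //; apply/asboolP.
have /card_bijP[f0 f0bij] : [set: T] #= seg x by rewrite card_eq_sym.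
pose f (a : T) : T := val (f0 (SigSub (mem_setT a))).
have fx a : seg x (f a) by exact: set_valP.
have fI : injective f.
  by move=> a b /val_inj /(bij_inj f0bij) [].
exists (relpre f R); split.
  move=> A [a aA].
  have [|z [[zin zmin] _]] := Rwo [pred y | `[< exists2 b, b \in A & f b = y >]].
    by exists (f a); apply/asboolP; exists a.
  have /asboolP[b bA bz] := zin; exists b; split.
    split=> // c cA /=; rewrite bz; apply: zmin.
    by apply/asboolP; exists c.
  move=> c [cA cmin]; apply/fI/anti.
  have bc : R (f b) (f c) by rewrite bz; apply: zmin; apply/asboolP; exists c.
  by rewrite bc; exact: cmin.
move=> a; split => // aT.
have /andP[fax nfax] := fx a; have [_] := lt_small _ fax nfax; apply.
apply/card_eqPle; split => //.
apply: (card_le_trans (B := [set y | relpre f R y a && (y != a)])).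
  by rewrite (card_le_eqr aT).
apply: (@set_inj_card_le _ _ f) => [b /= /andP[ba nba]|b c _ _ /fI//].
by rewrite /seg /= ba /= (inj_eq fI).
Qed.

Lemma cofinalityP : is_cofinality (cofinality T).
Proof.
apply: xgetPex; have [R Rwo] := ex_initial_well_order.
have [|C CR Cmin] := @ex_min_card (cofinal R); last by exists C; exists R.
have Rch : wo_chain R predT by move=> A _; case: Rwo => + _; exact.
by exists setT => x; exists x => //; exact: (wo_chain_reflexive Rch).
Qed.

End CofinalityExists.

(* Main.v *)
(** A preimage of a subalgebra of J/theta of full size is a subalgebra of J of
    full size, hence all of J; so a theta-class of size |J|, viewed as an
    element, generates J/theta. Such a class exists in (2): otherwise each class
    injects into a proper initial segment of |J|, and as |J/theta| < cf(|J|) a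
    single initial segment S works for all of them, so |J| <= |J/theta| * |S|
    with both factors below |J|. In (2'), |J| = |J/theta| * |class| forces every
    class to have size |J|. Both arguments rest on m * m = m for infinite
    cardinals m, proved with Zorn's lemma. *)
Require Import Defs.
From mathcomp Require Import all_boot generic_quotient.
From mathcomp Require Import boolp classical_sets functions cardinality.
From mathcomp Require Import wochoice.

Set Implicit Arguments.
Unset Strict Implicit.
Unset Printing Implicit Defensive.

Local Open Scope classical_set_scope.
Local Open Scope card_scope.

(** * Comparison of cardinals *)

Lemma card_le_inj (T U : Type) (A : set T) (B : set U) (f : T -> U) :
  set_fun A B f -> set_inj A f -> A #<= B.
Proof.
move=> fAB fI; have [g] : $|{injfun A >-> B}| by apply/injfunPex; exists f.
exact: inj_card_le.
Qed.

Lemma card_le_injP (T U : Type) (u : U) (A : set T) (B : set U) :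
  A #<= B -> exists2 f : T -> U, set_fun A B f & set_inj A f.
Proof.
elim/Ppointed: U => U in u B *; first by case: (no u).
by move=> /pcard_leP/injfunPex.
Qed.

Lemma card_le_nonempty (T U : Type) (A : set T) (B : set U) :
  A #<= B -> A !=set0 -> B !=set0.
Proof.
move=> AB; apply: contraPP => /nonemptyPn B0.
by move: AB; rewrite B0 => /card_le0P -> [].
Qed.

(** [ex_min_card] compares subsets of a single type, so it is applied to the copies of [A] and [B]
    in the sum type. *)
Lemma card_le_total (T U : Type) (A : set T) (B : set U) : A #<= B \/ B #<= A.
Proof.
elim/Ppointed: T => T in A *; first by left; rewrite emptyE.
elim/Ppointed: U => U in B *; first by right; rewrite emptyE.
have eA : @inl T U @` A #= A by apply: inj_card_eq => x y _ _ [].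
have eB : @inr T U @` B #= B by apply: inj_card_eq => x y _ _ [].
rewrite -(card_le_eql eA) -(card_le_eqr eB) -(card_le_eql eB) -(card_le_eqr eA).
have [|C [->|->] leC] := @ex_min_card (T + U)%type [set inl @` A; inr @` B].
- by exists (inl @` A); left.
- by left; apply: leC; right.
- by right; apply: leC; left.
Qed.

(** * Squares of infinite cardinals *)

Section Square.
Context {T : Type}.
Implicit Types F M : set (T * T * T).

Let support F : set T := [set x | exists y z, F (x, y, z)].

(* [F] contains the graph of an injection of [S * S] into [S], where [S] is its
   support; single-valuedness is not required, so that choice recovers it. *)
Let square_inj F : Prop :=
  [/\ forall x y z, F (x, y, z) -> support F y /\ support F z,
      forall x y, support F x -> support F y -> exists z, F (x, y, z) &
      forall x y x' y' z, F (x, y, z) -> F (x', y', z) -> (x, y) = (x', y')].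

(** Each clause of [square_inj] involves at most two triples, and any two members of a chain lie in
    a common member. *)
Let square_inj_bigcup (K : set (set (T * T * T))) :
  K `<=` square_inj -> total_on K subset -> square_inj (\bigcup_(X in K) X).
Proof.
move=> KP Ktot.
have common X Y : K X -> K Y -> exists2 Z, K Z & X `<=` Z /\ Y `<=` Z.
  by move=> KX KY; have [XY|YX] := Ktot _ _ KX KY; [exists Y|exists X];
    rewrite //; split.
have suppP X : K X -> support X `<=` support (\bigcup_(X in K) X).
  by move=> KX x [y [z Xxyz]]; exists y, z, X.
split.
- move=> x y z [X KX Xxyz]; have [+ _ _] := KP _ KX.
  by move=> /(_ _ _ _ Xxyz)[Xy Xz]; split; exact: suppP KX _ _.
- move=> x y [x' [x'' [X KX Xx]]] [y' [y'' [Y KY Yy]]].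
  have [Z KZ [XZ YZ]] := common _ _ KX KY; have [_ + _] := KP _ KZ.
  move=> /(_ x y)[||z Zxyz]; last by exists z, Z.
  + by exists x', x''; exact: XZ.
  + by exists y', y''; exact: YZ.
- move=> x y x' y' z [X KX Xz] [Y KY Yz].
  have [Z KZ [XZ YZ]] := common _ _ KX KY; have [_ _ +] := KP _ KZ.
  by apply; [exact: XZ Xz|exact: YZ Yz].
Qed.

Let square_inj_fun M (D := support M) : square_inj M ->
  exists f : T -> T -> T, [/\ forall x y, D x -> D y -> M (x, y, f x y),
    forall x y, D x -> D y -> D (f x y) &
    forall x y x' y', D x -> D y -> D x' -> D y' -> f x y = f x' y' ->
      x = x' /\ y = y'].
Proof.
move=> [Mcl Mtot Minj].
have /choice[f fP] : forall p : T * T, exists z, D p.1 -> D p.2 -> M (p, z).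
  move=> [x y]; have [[Dx Dy]|nD] := pselect (D x /\ D y).
    by have [z Mz] := Mtot _ _ Dx Dy; exists z.
  by exists x => Dx Dy; case: nD.
have fM x y : D x -> D y -> M (x, y, f (x, y)) by move=> Dx Dy; exact: fP.
exists (fun x y => f (x, y)); split=> // [x y Dx Dy|x y x' y' Dx Dy Dx' Dy' e].
  by have [] := Mcl _ _ _ (fM _ _ Dx Dy).
have := fM _ _ Dx' Dy'; rewrite -e.
by move=> /(Minj _ _ _ _ _ (fM _ _ Dx Dy))[-> ->].
Qed.

(** The countable starting point for Zorn's lemma: the pairing function of [nat], transported along
    [i]. *)
Let nat_square (i : nat -> T) : set (T * T * T) :=
  range (fun p : nat * nat => (i p.1, i p.2, i (choice.pickle p))).

Let nat_square_inj (i : nat -> T) : injective i -> square_inj (nat_square i).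
Proof.
move=> iI; set F := nat_square i.
have Fi n : support F (i n).
  by exists (i n), (i (choice.pickle (n, n))), (n, n).
split.
- by move=> _ _ _ [[m n] _ [_ <- <-]].
- move=> _ _ [_ [_ [[m n] _ [<- _ _]]]] [_ [_ [[m' n'] _ [<- _ _]]]].
  by exists (i (choice.pickle (m, m'))), (m, m').
- move=> _ _ _ _ _ [[m n] _ [<- <- <-]] [[m' n'] _ [<- <-]] /= /iI.
  by move=> /(pcan_inj choice.pickleK)[-> ->].
Qed.

(* Three copies of [S * S] fit into [S], so the injection of [S * S] extends to
   the square of the union of [S] and its image under [g]. *)
Let square_inj_extend M (g : T -> T) (i : nat -> T) : square_inj M ->
    injective i -> (forall n, support M (i n)) ->
    set_fun (support M) (~` support M) g -> set_inj (support M) g ->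
  exists2 M', square_inj M' & M `<` M'.
Proof.
move=> Mgood iI Di gD gI; have [f [fM fD fI]] := square_inj_fun Mgood.
have [Mcl _ Minj] := Mgood; set D := support M in Di gD gI fM fD fI Mcl *.
pose E := D `|` g @` D.
(* [k] folds [E] back onto [D]: the identity on [D], an inverse of [g] on the image of [D]. *)
have /choice[k kP] : forall x, exists y, E x ->
    D y /\ (if x \in D then y = x else g y = x).
  move=> x; have [Dx|nDx] := boolP (x \in D).
    by exists x => _; split=> //; exact/set_mem.
  have [Ex|nEx] := pselect (E x); last by exists x.
  case: Ex => [Dx|[y Dy yx]]; last by exists y.
  by move: nDx; rewrite (mem_set Dx).
(* The tag [c] tells apart the three parts of [E * E] outside [D * D]. The code [h] lands in [D];
   applying [g] to it keeps the new values away from those of [M]. *)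
pose c x y := if x \in D then 0%N else if y \in D then 1%N else 2%N.
pose h x y := f (i (c x y)) (f (k x) (k y)).
pose N : set (T * T * T) := [set p |
  [/\ E p.1.1, E p.1.2, ~ (D p.1.1 /\ D p.1.2) & p.2 = g (h p.1.1 p.1.2)]].
have kD x : E x -> D (k x) by move=> /kP[].
have hD x y : E x -> E y -> D (h x y).
  by move=> Ex Ey; apply: (fD) => //; apply: fD; exact: kD.
have kI x x' : E x -> E x' -> (x \in D) = (x' \in D) -> k x = k x' -> x = x'.
  move=> /kP[_ +] /kP[_ +] e e'; rewrite e e'.
  by case: (x' \in D) => ex ex'; rewrite -ex.
have hI x y x' y' : E x -> E y -> E x' -> E y' ->
    ~ (D x /\ D y) -> ~ (D x' /\ D y') -> h x y = h x' y' -> (x, y) = (x', y').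
  move=> Ex Ey Ex' Ey' nD nD'.
  move=> /fI[||||/iI ic /fI[||||kx ky]];
    do ?[exact: kD|exact: Di|by apply: fD; exact: kD].
  (* Off [D * D], the tag determines which coordinates lie in [D]. *)
  have [Dxx Dyy] : (x \in D) = (x' \in D) /\ (y \in D) = (y' \in D).
    have nn u v : ~ (D u /\ D v) -> ~~ ((u \in D) && (v \in D)).
      by move=> nDuv; apply/andP => -[/set_mem Du /set_mem Dv]; exact: nDuv.
    move: ic (nn _ _ nD) (nn _ _ nD'); rewrite /c.
    by do 4 case: (_ \in _).
  by congr pair; exact: kI.
have suppE x : support (M `|` N) x <-> E x.
  split=> [[y [z [Mxyz|[]]]]//|Ex].
    by left; exists y, z.
  have [Dx|nDx] := pselect (D x).
    by have [y [z Mxyz]] := Dx; exists y, z; left.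
  by exists x, (g (h x x)); right; split=> // -[].
have Eg x y : E x -> E y -> E (g (h x y)).
  by move=> Ex Ey; right; exists (h x y) => //; exact: hD.
exists (M `|` N).
- split.
  + move=> x y z [/Mcl[Dy Dz]|[/= Ex Ey _ ->]].
      by split; apply/suppE; left.
    by split; apply/suppE => //; exact: Eg.
  + move=> x y /suppE Ex /suppE Ey.
    have [[Dx Dy]|nD] := pselect (D x /\ D y).
      by exists (f x y); left; exact: fM.
    by exists (g (h x y)); right.
  + move=> x y x' y' z [Mz|[/= Ex Ey nD ez]] [Mz'|[/= Ex' Ey' nD' ez']].
    * exact: Minj Mz Mz'.
    * have [_ Dz] := Mcl _ _ _ Mz; exfalso; apply: (gD (h x' y')) => /=.
        exact: hD.
      by rewrite -ez'.
    * have [_ Dz] := Mcl _ _ _ Mz'; exfalso; apply: (gD (h x y)) => /=.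
        exact: hD.
      by rewrite -ez.
    * apply: hI => //; apply: gI; rewrite ?inE -?ez -?ez' //; exact: hD.
- split=> [p Mp|MNM]; first by left.
  (* The extension is strict because [g (i 0)] is a new point of the support. *)
  have nDg : ~ D (g (i 0%N)) by exact: gD.
  apply: nDg; have [|y [z []]] := (suppE (g (i 0%N))).2.
  + by right; exists (i 0%N).
  + by exists y, z.
  + by exists y, z; apply: MNM; right.
Qed.

Let square_inj_maximal (i : nat -> T) : injective i -> exists M,
  [/\ square_inj M, forall n, support M (i n) &
      forall M', M `<` M' -> ~ square_inj M'].
Proof.
move=> iI; have := nat_square_inj iI; set F0 := nat_square i => F0good.
(* The empty family has to be admitted, since it bounds the empty chain. *)
have [|M [[Mgood F0M] Mmax]] := @Zorn_bigcup _
    [set F | square_inj F /\ (F !=set0 -> F0 `<=` F)].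
  move=> K KP Ktot; split.
    by apply: square_inj_bigcup => // X /KP[].
  move=> [p [X KX Xp]] q F0q; exists X => //.
  by have [_] := KP _ KX; apply=> //; exists p.
have F0sub : F0 `<=` M.
  have [/F0M//|M0] := pselect (M !=set0).
  exfalso; apply: (Mmax F0); last by split=> // _; exact: subset_refl.
  split=> [p Mp|sub]; first by case: M0; exists p.
  apply: M0; exists (i 0%N, i 0%N, i (choice.pickle (0%N, 0%N))).
  by apply: sub; exists (0%N, 0%N).
exists M; split=> //.
  move=> n; exists (i n), (i (choice.pickle (n, n))).
  by apply: F0sub; exists (n, n).
move=> M' MM' M'good; apply: (Mmax M') => //; split=> // _.
by case: MM' => MM' _; exact: subset_trans F0sub MM'.
Qed.

(** Let [D] be the support of a maximal [M]. If [D] injected into its complement, [M] could be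
    extended; so the complement injects into [D]. Then [T] injects into two tagged copies of [D],
    hence into [D], and [T * T] into [D * D], hence into [D]. *)
Lemma card_le_square : infinite_set [set: T] -> [set: T * T] #<= [set: T].
Proof.
move=> infT; have [t _] := infinite_setN0 infT.
have [i _ iI] : exists2 f : nat -> T, set_fun setT setT f & set_inj setT f.
  exact/card_le_injP/infiniteP.
have {}iI : injective i by move=> m n /iI; apply; rewrite inE.
have [M [Mgood Di Mmax]] := square_inj_maximal iI.
have [|] := card_le_total (support M) (~` support M).
  move=> /(card_le_injP t)[g gD gI].
  by have [M' M'good /Mmax] := square_inj_extend Mgood iI Di gD gI.
move=> /(card_le_injP t)[g gD gI].
have [f [_ fD fI]] := square_inj_fun Mgood.
set D := support M in Di gD gI fD fI.
(* The distinct tags [i 0] and [i 1] keep the images of [D] and of its complement disjoint. *)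
pose h x := if x \in D then f (i 0%N) x else f (i 1%N) (g x).
have hD x : D (h x).
  rewrite /h; have [/set_mem Dx|/negP nDx] := boolP (x \in D); apply: fD => //.
  by apply: gD => Dx; apply: nDx; exact/mem_set.
have hI : injective h.
  move=> x y; rewrite /h.
  have gDn z : z \notin D -> D (g z).
    by move=> /negP nDz; apply: gD => Dz; apply: nDz; exact/mem_set.
  have [/set_mem Dx|nDx] := boolP (x \in D);
    have [/set_mem Dy|nDy] := boolP (y \in D).
  - by move=> /fI[].
  - by move=> /fI[||||/iI//]; rewrite //; exact: gDn.
  - by move=> /fI[||||/iI//]; rewrite //; exact: gDn.
  - move=> /fI[||||_]; do ?[exact: gDn|exact: Di].
    by apply: gI; rewrite inE => Dz; [case/negP: nDx|case/negP: nDy];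
      exact/mem_set.
apply: (@card_le_inj _ _ _ _ (fun p => f (h p.1) (h p.2))) => //.
by move=> [x y] [x' y'] _ _ /= /fI[||||/hI -> /hI ->].
Qed.

End Square.

(** * Products and fibers *)

Lemma card_le_prod (T U V : Type) : infinite_set [set: T] ->
  [set: T] #<= [set: U * V] -> [set: T] #<= [set: U] \/ [set: T] #<= [set: V].
Proof.
move=> infT TUV.
wlog UV : U V TUV / [set: U] #<= [set: V] => [le|].
  have [UV|VU] := card_le_total [set: U] [set: V]; first exact: le.
  have [|||] := le V U; [|exact: VU|by right|by left].
  apply: card_le_trans TUV _.
  apply: (@card_le_inj _ _ _ _ (fun p => (p.2, p.1))) => //.
  by move=> [x y] [x' y'] _ _ [-> ->].
have TVV : [set: T] #<= [set: V * V].
  have [t _] := infinite_setN0 infT.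
  have [|[u v] _] := card_le_nonempty TUV; first by exists t.
  have [f _ fI] := card_le_injP v UV.
  apply: card_le_trans TUV _.
  apply: (@card_le_inj _ _ _ _ (fun p => (f p.1, p.2))) => //.
  by move=> [x y] [x' y'] _ _ [/fI xx' ->]; rewrite xx' ?inE.
(* The larger factor [V] is infinite: otherwise [V * V], and with it [T], would be finite. *)
right; apply: (card_le_trans TVV); apply: card_le_square => finV; apply: infT.
apply: card_le_finite TVV _.
by rewrite -setXTT; exact: finite_setX.
Qed.

(** A point is determined by its fiber together with its code under an injection of that fiber into
    [U], chosen once per fiber. *)
Lemma card_le_fibers (T Q U : Type) (p : T -> Q) :
    (forall q, p @^-1` [set q] #<= [set: U]) ->
  [set: T] #<= [set: Q * U].
Proof.
move=> pU; have [[t _]|T0] := pselect ([set: T] !=set0); last first.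
  have -> : [set: T] = set0 by apply/seteqP; split=> // t _; case: T0; exists t.
  exact: card_ge0.
have [|u _] := card_le_nonempty (pU (p t)); first by exists t.
have /choice[g gI] q : exists g : T -> U, set_inj (p @^-1` [set q]) g.
  by have [g _ gI] := card_le_injP u (pU q); exists g.
apply: (@card_le_inj _ _ _ _ (fun t => (p t, g (p t) t))) => //.
by move=> x y _ _ [pxy]; rewrite pxy; apply: gI; exact/mem_set.
Qed.

(** * Well-orders and their initial segments *)

Lemma well_order_wo_chain (T : eqType) (R : rel T) :
  well_order R -> wo_chain R predT.
Proof. by move=> Rwo A _; exact: Rwo. Qed.

Lemma well_order_total (T : eqType) (R : rel T) : well_order R -> total R.
Proof. by move=> /well_order_wo_chain/wo_chainW Rtot x y; exact: Rtot. Qed.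

Lemma well_order_antisymmetric (T : eqType) (R : rel T) :
  well_order R -> antisymmetric R.
Proof.
by move=> /well_order_wo_chain/wo_chain_antisymmetric Ranti x y; exact: Ranti.
Qed.

(** The least of [x], [y], [z] is below all three; when it is [y] or [z], antisymmetry identifies
    two of them. *)
Lemma well_order_transitive (T : eqType) (R : rel T) :
  well_order R -> transitive R.
Proof.
move=> Rwo y x z xy yz; have Ranti := well_order_antisymmetric Rwo.
have [|m [[mxyz mmin] _]] := Rwo (pred3 x y z).
  by exists x; rewrite inE eqxx.
have [mx my mz] : [/\ R m x, R m y & R m z].
  by split; apply: mmin; rewrite !inE eqxx ?orbT.
move: mxyz; rewrite !inE => /or3P[] /eqP em; subst m => //.
- by rewrite (Ranti x y) // xy.
- by rewrite -(Ranti y z) // yz.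
Qed.

(* Transfinite recursion over [T]: an injection into [X] can always be continued
   while the values already taken do not exhaust [X]. *)
Lemma card_le_segment (T : choiceType) (R : rel T) (X : set T) :
    initial_well_order R -> X #< [set: T] ->
  exists b, X #<= [set y | R y b && (y != b)].
Proof.
move=> [Rwo _] [_ nXT]; apply: contrapT => /forallNP noseg; apply: nXT.
apply/card_eqPle; split; first exact: card_leT.
pose S y x := R y x && (y != x).
have Rtot := well_order_total Rwo.
have Swf : well_founded S.
  move=> x; apply: contrapT => nAx.
  have [|z [[/asboolP nAz zmin] _]] := Rwo [pred y | `[< ~ Acc S y >]].
    by exists x; apply/asboolP.
  apply: nAz; constructor=> y /andP[yz nyz]; apply: contrapT => nAy.
  move/eqP: nyz; apply; apply: (well_order_antisymmetric Rwo).
  by rewrite yz zmin //; apply/asboolP.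
pose step (x : T) (h : forall y, S y x -> T) :=
  xget x [set z | X z /\ forall y (yx : S y x), h y yx <> z].
pose h := Fix Swf (fun=> T) step.
have hE x : h x = xget x [set z | X z /\ forall y, S y x -> h y <> z].
  rewrite /h Fix_eq //; last first.
    move=> y u v uv; congr step.
    apply/functional_extensionality_dep => z.
    exact/functional_extensionality_dep.
have hP x : X (h x) /\ forall y, S y x -> h y <> h x.
  have := @xgetPex _ x [set z | X z /\ forall y, S y x -> h y <> z].
  rewrite -hE; apply; apply: contrapT => nz; apply: (noseg x).
  (* Without a fresh value, [X] is covered by the image of the segment below [x], so it is no larger
     than that segment. *)
  have Xim : X `<=` h @` [set y | S y x].
    move=> z Xz; apply: contrapT => nhz; apply: nz; exists z.
    by split=> // y yx hy; apply: nhz; exists y.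
  exact: card_le_trans (subset_card_le Xim) (card_image_le _ _).
apply: (@card_le_inj _ _ _ _ h) => [x _|x y _ _ hxy]; first by have [] := hP x.
apply: contrapT => /eqP nxy; have [xy|yx] := orP (Rtot x y).
- by have [_ /(_ x)] := hP y; apply=> //; rewrite /S xy.
- by have [_ /(_ y)] := hP x; apply=> //; rewrite /S yx eq_sym.
Qed.

(** * Quotients of Jónsson algebras *)

Section Quotients.
Local Open Scope quotient_scope.
Context {L : language} {A : algebra L} (theta : congruence A).

Let pi (x : A) : quotient theta := \pi_{eq_quot theta} x.

Lemma pi_surj (q : quotient theta) : exists x, pi x = q.
Proof. by exists (repr (q : {eq_quot theta})); exact: reprK. Qed.

Lemma pi_fiber (x : A) : pi @^-1` [set pi x] = class_of theta x.
Proof.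
rewrite /class_of; apply/seteqP; split=> y /=.
  by move=> /esym/eqmodP.
by move=> /eqmodP/esym.
Qed.

Lemma subalgebra_preimage_pi (B : set (quotient theta)) :
  subalgebra B -> subalgebra (pi @^-1` B).
Proof.
by move=> Bsub f xs Bxs; rewrite /preimage /= /pi -interp_pi; exact: Bsub.
Qed.

Lemma quotient_subalgebraT (B : set (quotient theta)) : jonsson A ->
  subalgebra B -> [set: A] #<= pi @^-1` B -> B = [set: quotient theta].
Proof.
move=> [_ _ Amax] Bsub AB.
have BT : pi @^-1` B = [set: A].
  apply: Amax; first exact: subalgebra_preimage_pi.
  by apply/card_eqPle; split=> //; exact: card_leT.
apply/seteqP; split=> // q _; have [x <-] := pi_surj q.
by have : (pi @^-1` B) x by rewrite BT.
Qed.

Lemma jonsson_quotient : jonsson A ->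
  [set: quotient theta] #= [set: A] -> jonsson (quotient theta).
Proof.
move=> JA QA; have [cL infA _] := JA; split=> //.
  by rewrite (eq_finite_set QA).
move=> B Bsub BQ; apply: quotient_subalgebraT => //.
rewrite -(card_le_eql QA) -(card_le_eql BQ).
(* As [B] has the size of [A], it is enough that the preimage of [B] maps onto [B]. *)
have BI : B `<=` pi @` (pi @^-1` B).
  move=> q Bq; have [x xq] := pi_surj q; exists x => //=.
  by rewrite /preimage /= xq.
exact: card_le_trans (subset_card_le BI) (card_image_le _ _).
Qed.

Lemma generated_by_large_class (x : A) : jonsson A ->
  [set: A] #<= class_of theta x -> generated_by (pi x).
Proof.
move=> JA Ax; apply: quotient_subalgebraT => //.
  by move=> f xs gxs B [Bsub xB]; apply: (Bsub) => i; exact: gxs.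
apply: card_le_trans Ax _; apply: subset_card_le; rewrite -pi_fiber => y /= yx.
by rewrite /preimage /= yx; exact: sub_gen_smallest.
Qed.

Lemma cyclic_quotient : jonsson A ->
  [set: quotient theta] #< cofinality A -> cyclic (quotient theta).
Proof.
move=> JA [QleC nQC]; have [_ infA _] := JA.
have [R [Rwo Rseg] [_ Cmin]] := @cofinalityP A.
have nQ (D : set A) : cofinal R D -> ~ (D #<= [set: quotient theta]).
  move=> /Cmin CD DQ; apply: nQC; apply/card_eqPle; split=> //.
  exact: card_le_trans CD DQ.
have Rtot := well_order_total Rwo.
have Rrefl x : R x x by have := Rtot x x; rewrite orbb.
(* By reflexivity, the whole of [A] is cofinal. *)
have nAQ : ~ ([set: A] #<= [set: quotient theta]).
  by apply: nQ => x; exists x.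
apply: contrapT => ncyc.
(* A class as large as [A] would give a generator, so every class is smaller and fits into a proper
   segment. *)
have /choice[b bP] (q : quotient theta) : exists b,
    pi @^-1` [set q] #<= [set y | R y b && (y != b)].
  apply: (@card_le_segment _ R) => //; split; first exact: card_leT.
  have [x <-] := pi_surj q; rewrite pi_fiber => /card_eqPle[_ Ax].
  by apply: ncyc; exists (pi x); exact: generated_by_large_class.
(* Otherwise the bounds [b q] would form a cofinal set no larger than the quotient. By totality, [c]
   lies above all of them. *)
have [c cP] : exists c, forall q, ~ R c (b q).
  apply: contrapT => /forallNP bcof; apply: (nQ (range b)).
    move=> x; have /existsNP[q /contrapT xq] := bcof x.
    by exists (b q) => //; exists q.
  exact: card_image_le.
have [||AQ|Ac] :=
    @card_le_prod A (quotient theta) [set y | R y c && (y != c)] => //.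
  apply: (@card_le_fibers _ _ _ pi) => q; rewrite (card_le_eqr (card_setT _)).
  apply: card_le_trans (bP q) _; apply: subset_card_le => y /andP[yb nyb].
  have bc : R (b q) c by have /orP[/cP|] := Rtot c (b q).
  rewrite /= (well_order_transitive Rwo yb bc).
  apply: contra_neqN nyb => /eqP yc.
  by apply: (well_order_antisymmetric Rwo); rewrite yb yc.
have [_ nc] := Rseg c; apply: nc; apply/card_eqPle.
split; first exact: card_leT.
by rewrite -(card_le_eqr (card_setT _)).
Qed.

Lemma generated_by_quotient (x : quotient theta) : jonsson A ->
    uniform_congruence theta -> [set: quotient theta] #< [set: A] ->
  generated_by x.
Proof.
move=> JA unif [QA nQA]; have [_ infA _] := JA; have [a <-] := pi_surj x.
apply: generated_by_large_class => //.
(* Uniformity makes the class of [a] a common bound for all fibers, so [A] injects into the quotient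
   times this one class. *)
have [|AQ|Aa] := @card_le_prod A (quotient theta) (class_of theta a) infA.
- apply: (@card_le_fibers _ _ _ pi) => q; have [y <-] := pi_surj q.
  rewrite (card_le_eqr (card_setT _)) pi_fiber.
  by have /card_eqPle[] := unif y a.
- by exfalso; apply: nQA; apply/card_eqPle.
- by rewrite -(card_le_eqr (card_setT _)).
Qed.

End Quotients.

Theorem theorem2p1 (L : language) (J : algebra L) (theta : congruence J) :
  jonsson J ->
  [/\ [set: quotient theta] #= [set: J] -> jonsson (quotient theta),
      [set: quotient theta] #< cofinality J -> cyclic (quotient theta) &
      uniform_congruence theta -> [set: quotient theta] #< [set: J] ->
      forall x : quotient theta, generated_by x].
Proof.
move=> JJ; split.
- exact: jonsson_quotient.
- exact: cyclic_quotient.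
- by move=> unif QJ x; exact: generated_by_quotient.
Qed.
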